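(* Let $a:\mathbb{R}^2\times\mathfrak{M}\to\mathbb{R}^2$ be Lipschitz in both variables and such that $a(\cdot,\mu)\in C^1_b(\mathbb{R}^2)$ for every $\mu\in\mathfrak{M}$. Let $D\subset\mathbb{R}^2$ be a closed domain, let $\varepsilon>0$, and let $\mu_0\in\mathfrak{M}_D$. Suppose that for every $\mu\in\mathfrak{M}_{D^\varepsilon}$, $$\langle a(x,\mu),\xi\rangle\le 0\qquad\text{for every }x\in D\text{ and every }\xi\in\hat N_D(x).$$ Then $D$ is flow invariant with respect to the differential equation with interaction $$dx(u,t)=a(x(u,t),\mu_t)\,dt,\quad x(u,0)=u,\ u\in D,\quad \mu_t=\mu_0\circ x(\cdot,t)^{-1},$$ i.e. $u\in D$ implies $x(u,t)\in D$ for all $t\ge0$.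
   Context: $\mathfrak{M}$ is the space of all Borel probability measures on $\mathbb{R}^2$ with the distance $\gamma(\mu,\nu)=\inf_{\kappa}\iint \frac{\|u-v\|}{1+\|u-v\|}\,\kappa(du,dv)$, the infimum being over all couplings $\kappa$ of $\mu$ and $\nu$. Lipschitz in both variables means: there is $L$ with $\|a(u_1,\mu_1)-a(u_2,\mu_2)\|\le L(\|u_1-u_2\|+\gamma(\mu_1,\mu_2))$ for all arguments; for such $a$ the equation with interaction is known to have a unique solution. $C^1_b(\mathbb{R}^2)$ denotes bounded continuously differentiable functions with bounded derivatives. For $S\subset\mathbb{R}^2$, $\mathfrak{M}_S=\{\mu\in\mathfrak{M}:\mu(\mathbb{R}^2\setminus S)=0\}$ and $S^\varepsilon=\{x\in\mathbb{R}^2:\operatorname{dist}(x,S)\le\varepsilon\}$. $\hat N_S(x_0)$, for $x_0\in S$, is the regular normal cone: the set of vectors $v$ such that $\langle v,x-x_0\rangle\le o(|x-x_0|)$ for $x\in S$ as $|x-x_0|\to0$. *)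

(* Defs.v *)
From HB Require Import structures.
From mathcomp Require Import all_boot all_order all_algebra.
From mathcomp Require Import all_classical all_reals all_analysis.
Set Implicit Arguments.
Unset Strict Implicit.
Unset Printing Implicit Defensive.
Import Order.TTheory GRing.Theory Num.Theory.
Import numFieldNormedType.Exports.

Local Open Scope classical_set_scope.
Local Open Scope ring_scope.

(* [R * R] carries the product topology and the product sigma-algebra, which is
   the Borel one. Its library norm is the max norm, hence [enorm] below. *)
Notation plane R := (R * R)%type (only parsing).

Definition dotp (R : realType) (v w : plane R) : R :=
  v.1 * w.1 + v.2 * w.2.

Definition enorm (R : realType) (v : plane R) : R := Num.sqrt (dotp v v).

Definition coupling (R : realType) (mu nu : probability (plane R) R) :
    set (probability (plane R * plane R)%type R) :=
  [set kappa | forall A : set (plane R), measurable A ->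
     kappa (A `*` setT) = mu A /\ kappa (setT `*` A) = nu A].

(* [fine] is harmless: couplings exist and the integrand lies in [0, 1[. *)
Definition gamma (R : realType) (mu nu : probability (plane R) R) : R :=
  fine (ereal_inf
    [set (\int[kappa]_w (enorm (w.1 - w.2)%R / (1 + enorm (w.1 - w.2))%R)%:E)%E
       | kappa in coupling mu nu]).

Definition lipschitz_both (R : realType)
    (a : plane R -> probability (plane R) R -> plane R) : Prop :=
  exists L : R, forall u1 u2 mu1 mu2,
    enorm (a u1 mu1 - a u2 mu2) <= L * (enorm (u1 - u2) + gamma mu1 mu2).

(* Continuity and boundedness of all directional derivatives of a
   differentiable map amount to those of its Jacobian matrix. *)
Definition C1b (R : realType) (f : plane R -> plane R) : Prop :=
  [/\ forall x, differentiable f x,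
      forall v : plane R, continuous ('D_v f),
      bounded_fun f
    & forall v : plane R, bounded_fun ('D_v f)].

Definition closed_domain (R : realType) (D : set (plane R)) : Prop :=
  exists G : set (plane R),
    [/\ open G, connected G, G !=set0 & D = closure G].

Definition prob_on (R : realType) (S : set (plane R)) :
    set (probability (plane R) R) :=
  [set mu | mu (~` S) = 0%E].

(* The distance is extended-real-valued, so that dist(x, set0) = +oo. *)
Definition dist (R : realType) (x : plane R) (S : set (plane R)) : \bar R :=
  ereal_inf [set (enorm (x - y))%:E | y in S].

Definition enlarge (R : realType) (S : set (plane R)) (eps : R) :
    set (plane R) :=
  [set x | (dist x S <= eps%:E)%E].

(* <v, x - x0> <= o(|x - x0|) for x in S, the one-sided little-o unfolded. *)
Definition regular_normal_cone (R : realType) (S : set (plane R))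
    (x0 : plane R) : set (plane R) :=
  [set v | forall e : R, 0 < e ->
     \forall x \near x0, S x -> dotp v (x - x0) <= e * enorm (x - x0)].

(* [x u t] is constrained only for [u] in [D] and [0 <= t]. As [mu0] gives no
   mass to the complement of [D], the last clause says that [mu t] is the image
   of [mu0] under [x ^~ t]. The derivative at [t = 0] is the right one, and is
   given by the equation at [0 < t] together with the continuity at 0. *)
Definition solution (R : realType)
    (a : plane R -> probability (plane R) R -> plane R)
    (mu0 : probability (plane R) R) (D : set (plane R))
    (x : plane R -> R -> plane R) (mu : R -> probability (plane R) R) : Prop :=
  [/\ forall u, D u -> x u 0 = u,
      forall u, D u -> {within `[0, +oo[, continuous (x u)},
      forall u t, D u -> 0 < t ->
        is_derive (t : R^o) 1 (x u) (a (x u t) (mu t)),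
      forall t, 0 <= t -> measurable_fun D (x ^~ t)
    & forall t A, 0 <= t -> measurable A ->
        mu t A = mu0 (D `&` (x ^~ t) @^-1` A)].

Definition flow_invariant (R : realType)
    (a : plane R -> probability (plane R) R -> plane R)
    (mu0 : probability (plane R) R) (D : set (plane R)) : Prop :=
  forall x mu, solution a mu0 D x mu ->
  forall u t, D u -> 0 <= t -> D (x u t).

(* Main.v *)
(* If the flow keeps [D] up to time [T], it moves by at most [eps] during
   [T, T + delta], since gamma <= 1 makes [a] uniformly bounded; so [mu t] stays
   on [enlarge D eps] and the inward condition is available there. With [y] a
   nearest point of [D] to [x t], the vector [x t - y] is regular normal at [y],
   whence dist(x t, D)^2 has upper right derivative at most 2 K dist(x t, D)^2,
   [K] being the Lipschitz constant of [a] in space, and the distance stays 0.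
   As [delta] does not depend on [T], the argument iterates to all times. *)
Require Import Defs.
From HB Require Import structures.
From mathcomp Require Import all_boot all_order all_algebra.
From mathcomp Require Import all_classical all_reals all_analysis measurable_realfun.
From mathcomp Require Import ring lra.
Set Implicit Arguments.
Unset Strict Implicit.
Unset Printing Implicit Defensive.
Import Order.TTheory GRing.Theory Num.Theory.
Import numFieldNormedType.Exports.
Local Open Scope classical_set_scope.
Local Open Scope ring_scope.

(** * The Euclidean norm against the max norm of the library, and Borel sets of the plane *)

Section Euclidean.
Context {R : realType}.
Implicit Types (v w p q : plane R) (c : R).

Lemma dotp_ge0 v : 0 <= dotp v v.
Proof. by rewrite /dotp addr_ge0 ?sqr_ge0// -expr2 sqr_ge0. Qed.

Lemma sqr_enorm v : enorm v ^+ 2 = dotp v v.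
Proof. by rewrite sqr_sqrtr ?dotp_ge0. Qed.

Lemma enorm_ge0 v : 0 <= enorm v.
Proof. exact: sqrtr_ge0. Qed.

Lemma enorm0 : enorm (0 : plane R) = 0.
Proof. by rewrite /enorm /dotp !mulr0 addr0 sqrtr0. Qed.

Lemma enorm_le v c : 0 <= c -> (enorm v <= c) = (dotp v v <= c ^+ 2).
Proof. by move=> c0; rewrite -sqr_enorm ler_sqr ?nnegrE ?enorm_ge0. Qed.

Lemma cauchy_schwarz v w : dotp v w <= enorm v * enorm w.
Proof.
apply: le_trans (ler_norm _) _.
rewrite -ler_sqr ?nnegrE ?mulr_ge0 ?enorm_ge0 ?normr_ge0//.
rewrite exprMn !sqr_enorm real_normK ?num_real// -subr_ge0.
rewrite [leRHS](_ : _ = (v.1 * w.2 - v.2 * w.1) ^+ 2) ?sqr_ge0//.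
by rewrite /dotp; ring.
Qed.

Lemma enormN v : enorm (- v) = enorm v.
Proof. by rewrite /enorm /dotp /= !mulrNN. Qed.

Lemma enormB v w : enorm (v - w) = enorm (w - v).
Proof. by rewrite -opprB enormN. Qed.

Lemma enormD v w : enorm (v + w) <= enorm v + enorm w.
Proof.
rewrite enorm_le ?addr_ge0 ?enorm_ge0// sqrrD !sqr_enorm.
have := cauchy_schwarz v w; rewrite /dotp /=; lra.
Qed.

Lemma enorm_triangle p v w : enorm (v - w) <= enorm (v - p) + enorm (p - w).
Proof. by rewrite -[v - w](subrKA p) enormD. Qed.

Lemma enorm_le_l1 v : enorm v <= `|v.1| + `|v.2|.
Proof.
rewrite enorm_le ?addr_ge0// sqrrD !real_normK ?num_real// /dotp.
by rewrite -!expr2 addrAC lerDl mulrn_wge0// mulr_ge0.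
Qed.

Lemma enorm_le_norm v : enorm v <= 2 * `|v|.
Proof.
apply: le_trans (enorm_le_l1 v) _; rewrite prod_normE mulr_natl mulr2n.
by apply: lerD; rewrite le_max lexx ?orbT.
Qed.

Lemma norm1_le_enorm v : `|v.1| <= enorm v.
Proof.
rewrite -ler_sqr ?nnegrE ?enorm_ge0// sqr_enorm real_normK ?num_real//.
by rewrite /dotp -!expr2 lerDl sqr_ge0.
Qed.

Lemma norm2_le_enorm v : `|v.2| <= enorm v.
Proof.
rewrite -ler_sqr ?nnegrE ?enorm_ge0// sqr_enorm real_normK ?num_real//.
by rewrite /dotp -!expr2 lerDr sqr_ge0.
Qed.

Lemma norm_le_enorm v : `|v| <= enorm v.
Proof. by rewrite prod_normE ge_max norm1_le_enorm norm2_le_enorm. Qed.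

Lemma near_enorm_lt p c : 0 < c -> \forall q \near p, enorm (p - q) < c.
Proof.
move=> c0; have c20 : 0 < c / 2 by rewrite divr_gt0.
near=> q; apply: le_lt_trans (enorm_le_norm _) _.
rewrite -ltr_pdivlMl// mulrC.
near: q; apply: (@cvgr_dist_lt _ _ _ (nbhs p) _ id p) => //.
Unshelve. all: by end_near.
Qed.

Lemma enorm_dist_continuous p : continuous (fun q => enorm (p - q)).
Proof.
move=> q; apply/cvgrPdist_lt => e e0.
near=> r.
have rq : enorm (q - r) < e by near: r; exact: near_enorm_lt.
have := enorm_triangle q p r; have := enorm_triangle r p q.
by rewrite (enormB r q) ltr_norml; lra.
Unshelve. all: by end_near.
Qed.

Lemma measurable_enormB : measurable_fun setT
  (fun w : plane R * plane R => enorm (w.1 - w.2)).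
Proof.
have m11 : measurable_fun setT (fun w : plane R * plane R => w.1.1).
  by apply: (measurableT_comp measurable_fst measurable_fst).
have m12 : measurable_fun setT (fun w : plane R * plane R => w.1.2).
  by apply: (measurableT_comp measurable_snd measurable_fst).
have m21 : measurable_fun setT (fun w : plane R * plane R => w.2.1).
  by apply: (measurableT_comp measurable_fst measurable_snd).
have m22 : measurable_fun setT (fun w : plane R * plane R => w.2.2).
  by apply: (measurableT_comp measurable_snd measurable_snd).
apply: (measurableT_comp (continuous_measurable_fun (@sqrt_continuous R))).
by apply: measurable_funD; apply: measurable_funM; apply: measurable_funB.
Qed.

(** The open boxes with rational corners that lie in [U] cover it, and there are countably many of
    them; the other indices contribute [set0]. *)
Lemma open_measurable_plane (U : set (plane R)) : open U -> measurable U.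
Proof.
move=> oU.
pose box (i : rat * rat * (rat * rat)) : set (plane R) :=
  `]ratr i.1.1, ratr i.1.2[ `*` `]ratr i.2.1, ratr i.2.2[.
pose F i := if `[< box i `<=` U >] then box i else set0.
suff -> : U = \bigcup_i F i.
  apply: countable_bigcupT_measurable => // i; rewrite /F.
  by case: ifPn => // _; apply: measurableX; exact: measurable_itv.
apply/seteqP; split => [[x y] Uxy|xy [i _]]; last first.
  by rewrite /F; case: ifPn => // /asboolP; apply.
have /nbhs_ballP[e /= e0 He] : nbhs (x, y) U by exact: open_nbhs_nbhs.
have [|q1] := rat_in_itvoo (_ : x - e < x); first by lra.
have [|q2] := rat_in_itvoo (_ : x < x + e); first by lra.
have [|q3] := rat_in_itvoo (_ : y - e < y); first by lra.
have [|q4] := rat_in_itvoo (_ : y < y + e); first by lra.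
rewrite !in_itv /= => /andP[? ?] /andP[? ?] /andP[? ?] /andP[? ?].
exists ((q1, q2), (q3, q4)) => //; rewrite /F asboolT/=.
  by split; rewrite /= in_itv/=; apply/andP.
move=> [u v]; rewrite /box /= !in_itv /= => -[/andP[? ?] /andP[? ?]].
by apply: He; split; rewrite /= /ball /= ltr_norml; lra.
Qed.

End Euclidean.

(** * Elementary bounds on the transport distance *)

Section Gamma.
Context {R : realType}.
Implicit Types mu nu : probability (plane R) R.

Lemma measurable_gamma_cost : measurable_fun setT
  (fun w : plane R * plane R =>
     (enorm (w.1 - w.2)%R / (1 + enorm (w.1 - w.2))%R)%:E).
Proof.
apply/measurable_EFinP.
(* The absolute value makes [phi] continuous on the whole line; it agrees with the cost for
   [0 <= t]. *)
pose phi (t : R) : R := t / (1 + `|t|).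
have cphi : continuous phi.
  move=> t; apply: cvgM; first exact: cvg_id.
  apply: cvgV; first by rewrite gt_eqF// ltr_pwDl.
  by apply: cvgD; [exact: cvg_cst|exact: norm_continuous].
apply: (eq_measurable_fun (phi \o fun w => enorm (w.1 - w.2))).
  by move=> w _; rewrite /phi /= ger0_norm ?enorm_ge0.
by apply: measurableT_comp measurable_enormB; exact: continuous_measurable_fun.
Qed.

Lemma gamma_cost_ge0 (w : plane R * plane R) :
  0 <= enorm (w.1 - w.2) / (1 + enorm (w.1 - w.2)).
Proof. by rewrite divr_ge0 ?addr_ge0 ?enorm_ge0. Qed.

Lemma gamma_cost_le1 (w : plane R * plane R) :
  enorm (w.1 - w.2) / (1 + enorm (w.1 - w.2)) <= 1.
Proof.
by rewrite ler_pdivrMr ?mul1r ?lerDr// ltr_pwDl ?enorm_ge0.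
Qed.

Lemma gamma_ge0 mu nu : 0 <= gamma mu nu.
Proof.
apply: fine_ge0; apply: le_ereal_inf_tmp => _ [kappa _ <-].
by apply: integral_ge0 => w _; rewrite lee_fin gamma_cost_ge0.
Qed.

(** The infimum lies between 0 and [c], hence is finite, and [fine] preserves the inequality. *)
Lemma gamma_le_integral mu nu kappa (c : R) : coupling mu nu kappa ->
  (\int[kappa]_w (enorm (w.1 - w.2)%R / (1 + enorm (w.1 - w.2))%R)%:E
    <= c%:E)%E ->
  gamma mu nu <= c.
Proof.
move=> Ck kc; rewrite /gamma; set I := ereal_inf _.
have I0 : (0 <= I)%E.
  apply: le_ereal_inf_tmp => _ [k _ <-].
  by apply: integral_ge0 => w _; rewrite lee_fin gamma_cost_ge0.
have Ic : (I <= c%:E)%E.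
  by apply: le_trans kc; apply: ereal_inf_lbound; exists kappa.
by rewrite -lee_fin fineK// ge0_fin_numE// (le_lt_trans Ic)// ltry.
Qed.

Lemma gamma_le1 mu nu : gamma mu nu <= 1.
Proof.
have [[kappa Ck]|noC] := pselect (coupling mu nu !=set0).
  apply: (gamma_le_integral Ck).
  rewrite -(@probability_setT _ _ _ kappa) -[leRHS]mul1e -integral_cst//.
  apply: ge0_le_integral => //=.
  - by move=> w _; rewrite lee_fin gamma_cost_ge0.
  - exact: measurable_gamma_cost.
  - by move=> w _; rewrite lee_fin gamma_cost_le1.
(* without couplings, [gamma mu nu] would be [fine +oo = 0] *)
rewrite /gamma (_ : [set _ | _ in _] = set0) ?ereal_inf0//.
by rewrite -subset0 => r [kappa Ck _]; apply: noC; exists kappa.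
Qed.

Definition diag (u : plane R) : plane R * plane R := (u, u).

Lemma measurable_diag : measurable_fun setT diag.
Proof. by apply: measurable_fun_pair. Qed.

HB.instance Definition _ := @isMeasurableFun.Build _ _ _ _ diag measurable_diag.

(** The image of [mu] under [diag] is a coupling of zero cost. *)
Lemma gamma_diag mu : gamma mu mu = 0.
Proof.
apply/eqP; rewrite eq_le gamma_ge0 andbT.
apply: (@gamma_le_integral mu mu (distribution mu diag)).
  move=> A mA; rewrite /distribution /pushforward.
  by split; congr (mu _); apply/seteqP; split => [u []//|u Au].
rewrite ge0_integral_pushforward//=; last 2 first.
- exact: measurable_gamma_cost.
- by move=> w _; rewrite lee_fin gamma_cost_ge0.
rewrite integral0_eq// => u _ /=.
by rewrite subrr enorm0 mul0r.
Qed.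

End Gamma.

(** * Nearest points of a closed set *)

Section NearestPoint.
Context {R : realType}.
Variable D : set (plane R).
Hypotheses (D_closed : closed D) (D_neq0 : D !=set0).

Definition nearest (p y : plane R) :=
  D y /\ forall z, D z -> enorm (p - y) <= enorm (p - z).

(** The points of [D] no farther from [p] than [d0] lie in the compact set [Q] intersected with [D],
    where the distance attains its minimum; the other points of [D] are farther than [d0]. *)
Lemma nearest_exists p : exists y, nearest p y.
Proof.
have [d0 Dd0] := D_neq0; pose r := enorm (p - d0).
pose Q : set (plane R) := `[p.1 - r, p.1 + r] `*` `[p.2 - r, p.2 + r].
have inQ z : enorm (p - z) <= r -> Q z.
  move=> pz; have := le_trans (norm1_le_enorm _) pz.
  have := le_trans (norm2_le_enorm _) pz.
  by rewrite !ler_norml /= => ? ?; split; rewrite /= in_itv /=; lra.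
have cK : compact (Q `&` D).
  apply: (compact_closedI _ D_closed).
  by apply: compact_setX; exact: segment_compact.
have [|y] := compact_EVT_min _ cK (continuous_subspaceT (@enorm_dist_continuous R p)).
  by exists d0; split=> //; exact: inQ.
rewrite inE => -[_ Dy] ymin; exists y; split => // z Dz.
have [pz|/ltW pz] := leP (enorm (p - z)) r.
  by apply: ymin; rewrite inE; split => //; exact: inQ.
by apply: le_trans pz; apply: ymin; rewrite inE; split => //; exact: inQ.
Qed.

(** Expanding the squares in [enorm (p - y) <= enorm (p - z)] bounds twice the product of [p - y]
    and [z - y] by the square of [enorm (z - y)], which is quadratically small. *)
Lemma nearest_normal p y : nearest p y -> regular_normal_cone D y (p - y).
Proof.
move=> [_ ymin] e e0.
near=> z => /ymin; rewrite enorm_le ?enorm_ge0// sqr_enorm => pyz.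
have : dotp (p - y) (z - y) * 2 <= enorm (z - y) ^+ 2.
  by rewrite sqr_enorm; move: pyz; rewrite /dotp /=; lra.
have : enorm (z - y) < 2 * e.
  by rewrite enormB; near: z; apply: near_enorm_lt; rewrite mulr_gt0.
by have := enorm_ge0 (z - y); nra.
Unshelve. all: by end_near.
Qed.

Lemma nearest_enlarge p y eps :
  nearest p y -> enlarge D eps p <-> enorm (p - y) <= eps.
Proof.
move=> [Dy ymin]; rewrite /enlarge /= -lee_fin /dist.
suff -> : ereal_inf [set (enorm (p - z))%:E | z in D] = (enorm (p - y))%:E.
  by [].
apply/eqP; rewrite eq_le; apply/andP; split.
  by apply: ereal_inf_lbound; exists y.
by apply: le_ereal_inf_tmp => _ [z Dz <-]; rewrite lee_fin ymin.
Qed.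

Lemma mem_enlarge p y eps : D y -> enorm (p - y) <= eps -> enlarge D eps p.
Proof.
move=> Dy py; have [z nz] := nearest_exists p.
by apply/(nearest_enlarge _ nz); apply: le_trans py; apply: nz.2.
Qed.

(** The distance to [D] is 1-Lipschitz. This makes the complement of the enlargement measurable. *)
Lemma open_enlargeC eps : open (~` enlarge D eps).
Proof.
rewrite openE => p; have [y ny] := nearest_exists p.
rewrite /= (nearest_enlarge _ ny) => /negP; rewrite -ltNge => py.
rewrite /interior /=.
near=> q => /=; have [z nz] := nearest_exists q.
rewrite (nearest_enlarge _ nz) => qz.
have := ny.2 _ nz.1; have := enorm_triangle q p z.
suff : enorm (p - q) < enorm (p - y) - eps by lra.
by near: q; apply: near_enorm_lt; rewrite subr_gt0.
Unshelve. all: by end_near.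
Qed.

End NearestPoint.

(** Let [s] be the supremum of the times up to which [P] holds throughout. The left condition gives
    [P s], and the right condition would push past [s] if [s < b]. *)
Lemma real_induction (R : realType) (P : R -> Prop) (a b : R) :
  P a ->
  (forall s, a <= s < b -> P s -> exists2 e, 0 < e &
    forall h, 0 < h < e -> P (s + h)) ->
  (forall s, a < s <= b -> (forall r, a <= r < s -> P r) -> P s) ->
  forall t, a <= t <= b -> P t.
Proof.
move=> Pa Pright Pleft t /andP[at_ tb].
pose S := [set s | a <= s <= b /\ forall r, a <= r <= s -> P r].
have ab : a <= b by exact: le_trans tb.
have Sa : S a.
  split; first by rewrite lexx.
  by move=> r; rewrite -eq_le => /eqP <-.
have ubS : ubound S b by move=> s [/andP[]].
have supS : has_sup S by split; [exists a | exists b].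
set s := sup S.
have as_ : a <= s by apply: ub_le_sup => //; exists b.
have sb : s <= b by apply: ge_sup => //; exists a.
have Pbelow r : a <= r < s -> P r.
  move=> /andP[ar rs].
  have [|q [_ Sq] rq] := @sup_adherent _ S (s - r) _ supS; first by rewrite subr_gt0.
  by apply: Sq; rewrite ar ltW// (le_lt_trans _ rq)// subKr.
have Ps : P s.
  have [sa|] := leP s a; first by rewrite (_ : s = a)//; apply/le_anti/andP.
  by move=> as'; apply: Pleft => //; rewrite as'.
have PS r : a <= r <= s -> P r.
  by move=> /andP[ar]; rewrite le_eqVlt => /predU1P[->//|rs]; apply: Pbelow; rewrite ar.
have [bs|sltb] := leP b s; first by apply: PS; rewrite at_ (le_trans tb).
have [|e e0 Pe] := Pright s _ Ps; first by rewrite as_.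
(* Half of [e] keeps the steps up to [q] strictly below [e]. *)
pose q := Num.min b (s + e / 2).
have sq : s < q by rewrite /q lt_min sltb ltrDl divr_gt0.
suff : S q by move=> /(sup_upper_bound supS); rewrite leNgt sq.
split; first by rewrite (le_trans as_ (ltW sq))// /q ge_min lexx.
move=> r /andP[ar rq]; have [rs|sr] := leP r s; first by apply: PS; rewrite ar.
rewrite -(subrKC s r); apply: Pe; rewrite subr_gt0 sr/=.
by move: rq; rewrite le_min => /andP[_]; lra.
Qed.

(** * Differentiable curves in the plane *)

Section Trajectory.
Context {R : realType}.
Implicit Types (z : R -> plane R) (l : plane R).

(** Serves to reduce to the coordinates, where the scalar mean value theorem applies. *)
Lemma is_derive_comp_linear (g : plane R -> R) z l (t : R) :
  continuous g -> {morph g : v w / v - w} ->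
  (forall (k : R) v, g (k *: v) = k * g v) ->
  is_derive (t : R^o) 1 z l -> is_derive t 1 (g \o z) (g l).
Proof.
move=> cg gB gZ [dz <-].
have H : h^-1 *: ((g \o z \o shift t) (h *: 1) - (g \o z) t) @[h --> 0^']
    --> g ('D_1 (z : R^o -> plane R) t).
  under eq_fun do rewrite /= -gB /GRing.scale /= -gZ.
  exact: (cvg_comp _ _ dz (cg _)).
by split; [exact: cvgP H|exact: cvg_lim H].
Qed.

Lemma is_derive_right z l (s : R) e : 0 < e -> is_derive (s : R^o) 1 z l ->
  exists2 d, 0 < d &
    forall h, 0 < h < d -> enorm (z (s + h) - z s - h *: l) <= e * h.
Proof.
move=> e0 [dz <-].
(* The half compensates the factor 2 in [enorm_le_norm]. *)
have e20 : 0 < e / 2 by rewrite divr_gt0.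
move/cvgrPdist_le : (dz) => /(_ _ e20)/nbhs_ballP[d /= d0 dP].
exists d => // h /andP[h0 hd].
have := dP h; rewrite /ball /= sub0r normrN gtr0_norm// => /(_ hd).
rewrite gt_eqF// => /(_ isT).
set q := _ *: (_ - _) => dq.
have -> : z (s + h) - z s - h *: 'D_1 (z : R^o -> plane R) s =
    h *: (q - 'D_1 (z : R^o -> plane R) s).
  rewrite scalerBr /q scalerA mulfV ?gt_eqF// scale1r.
  by rewrite /GRing.scale/= mulr1 (addrC h).
apply: le_trans (enorm_le_norm _) _.
rewrite normrZ gtr0_norm// mulrCA mulrC ler_pM2r// -ler_pdivlMl// mulrC.
by rewrite distrC.
Qed.

(** The mean value theorem bounds each coordinate by [V * (t - s)]; adding the two gives the factor
    2. *)
Lemma lipschitz_of_bounded_derivative z (z' : R -> plane R) V (s t : R) :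
  0 <= s <= t ->
  {within `[0, +oo[, continuous z} ->
  (forall r, 0 < r -> is_derive (r : R^o) 1 z (z' r)) ->
  (forall r, 0 < r -> enorm (z' r) <= V) ->
  enorm (z t - z s) <= 2 * V * (t - s).
Proof.
move=> /andP[s0 st] cz dz z'V.
suff comp (g : plane R -> R) : continuous g -> {morph g : v w / v - w} ->
    (forall (k : R) v, g (k *: v) = k * g v) ->
    (forall v, `|g v| <= enorm v) -> `|g (z t - z s)| <= V * (t - s).
  apply: le_trans (enorm_le_l1 _) _; rewrite -mulrA mulr_natl mulr2n.
  apply: lerD; apply: comp => //.
  - by move=> v; exact: cvg_fst.
  - exact: norm1_le_enorm.
  - by move=> v; exact: cvg_snd.
  - exact: norm2_le_enorm.
move=> cg gB gZ gle; rewrite gB.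
move: st; rewrite le_eqVlt => /predU1P[->|st].
  by rewrite !subrr normr0 mulr0.
have [||c] := @MVT _ (g \o z) (g \o z') s t st.
- move=> r; rewrite in_itv/= => /andP[sr _].
  by apply: is_derive_comp_linear => //; apply: dz; exact: le_lt_trans sr.
- have : {within `[s, t], continuous z}.
    apply: continuous_subspaceW cz => r /=; rewrite !in_itv/= => /andP[sr _].
    by rewrite (le_trans s0).
  by move=> cz' r; exact: (cvg_comp _ _ (cz' r) (cg _)).
rewrite in_itv /= => /andP[sc _] ->.
rewrite normrM (gtr0_norm (_ : 0 < t - s)) ?subr_gt0// ler_pM2r ?subr_gt0//.
by apply: le_trans (gle _) _; apply: z'V; exact: le_lt_trans sc.
Qed.

End Trajectory.

(* Velocities are only assumed tangent on [D]; [K] transfers this to the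
   points [z s] off [D], and no regularity of [f] in time is needed. *)
Lemma viability (R : realType) (D : set (plane R)) (z : R -> plane R)
    (f : R -> plane R -> plane R) (K W a b : R) :
  closed D -> 0 <= K ->
  (forall s t, a <= s <= t -> enorm (z t - z s) <= W * (t - s)) ->
  (forall s, a < s < b -> is_derive (s : R^o) 1 z (f s (z s))) ->
  (forall s x y, enorm (f s x - f s y) <= K * enorm (x - y)) ->
  (forall s y xi, a < s < b -> D y -> regular_normal_cone D y xi ->
     dotp (f s y) xi <= 0) ->
  D (z a) -> forall t, a <= t <= b -> D (z t).
Proof.
move=> cD K0 zlip dz flip tangent Da t tab.
have D0 : D !=set0 by exists (z a).
have [pi piP] := choice (nearest_exists cD D0).
pose d s := enorm (z s - pi (z s)).
have dlip s r : d r <= d s + enorm (z r - z s).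
  apply: le_trans ((piP (z r)).2 _ (piP (z s)).1) _.
  by rewrite [leRHS]addrC; exact: enorm_triangle.
have da0 : d a = 0.
  by apply/le_anti; rewrite enorm_ge0 andbT -(enorm0 (R := R)) -(subrr (z a)) (piP _).2.
have W0 : 0 <= W.
  have := zlip a (a + 1); rewrite lexx lerDl ler01 => /(_ isT).
  by rewrite addrAC subrr add0r mulr1; apply: le_trans; exact: enorm_ge0.
have W1 : 0 < W + 1 by rewrite ltr_wpDl.
suff dle0 : d t <= 0.
  have : `|z t - pi (z t)| <= 0 by apply: le_trans (norm_le_enorm _) _.
  by rewrite normr_le0 subr_eq0 => /eqP ->; exact: (piP _).1.
(* The rate of the exponential barrier [w]: [K] for the growth of the distance, 1 for the
   second-order term in the squared norm, 1 for the remainder of the derivative. *)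
pose c := K + 2.
pose w n s := n * expR (c * (s - a)).
(* Here [n] is a real height of the barrier, which is then let tend to 0. *)
suff dw n : 0 < n -> d t <= w n t.
  apply/ler_addgt0Pr => e e0; rewrite add0r.
  have E0 := expR_gt0 (c * (t - a)).
  have := dw (e / expR (c * (t - a))) (divr_gt0 e0 E0).
  by rewrite /w divfK// gt_eqF.
move=> n0.
have w0 s : 0 < w n s by rewrite mulr_gt0// expR_gt0.
have wh s h : 0 <= h -> w n s * (1 + c * h) <= w n (s + h).
  move=> h0; rewrite /w -mulrA ler_pM2l//.
  rewrite (_ : c * (s + h - a) = c * (s - a) + c * h); last by ring.
  by rewrite expRD ler_pM2l ?expR_gt0// expR_ge1Dx.
have wmono s h : 0 <= h -> w n s <= w n (s + h).
  move=> h0; apply: le_trans (wh _ _ h0); apply: ler_peMr; first exact: ltW.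
  by rewrite lerDl mulr_ge0// addr_ge0.
move: t tab; apply: real_induction.
- by rewrite da0 ltW.
(* Strictly below the barrier, the Lipschitz bound on [z] leaves room for a short time; only contact
   with the barrier requires the tangency condition. *)
- move=> s /andP[as_ sb]; rewrite le_eqVlt => /predU1P[dsE|ds_lt]; last first.
    exists ((w n s - d s) / (W + 1)).
      by rewrite divr_gt0 ?subr_gt0.
    move=> h /andP[h0 hlt]; apply: le_trans (dlip s _) _.
    apply: le_trans (wmono s h (ltW h0)).
    rewrite -lerBrDl; apply: le_trans (zlip _ _ _) _.
      by rewrite as_ lerDl ltW.
    rewrite addrAC subrr add0r.
    by move: hlt; rewrite ltr_pdivlMr//; lra.
  (* No contact occurs at [a], where [d] vanishes, so the derivative is available at [s]. *)
  have sa : a < s.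
    rewrite lt_neqAle as_ andbT; apply/eqP => sE.
    by have := w0 s; rewrite -dsE -sE da0 ltxx.
  set r := w n s in dsE; have r0 : 0 < r := w0 s.
  set y := pi (z s); set l := f s (z s).
  (* The tolerance is [r] itself, so the remainder is at most [r * h]. *)
  have [e e0 eP] := is_derive_right r0 (dz s (introT andP (conj sa sb))).
  (* [y] is a nearest point, so [z s - y] is normal and [d^2] grows at rate
     at most [2 K d^2]. *)
  have ly : dotp (z s - y) l <= K * r ^+ 2.
    have := tangent s y (z s - y) (introT andP (conj sa sb)) (piP _).1
      (nearest_normal (piP (z s))).
    have := cauchy_schwarz (z s - y) (l - f s y).
    have := flip s (z s) y; rewrite -/l -/(d s) dsE => flip1.
    have := ler_wpM2l (ltW r0) flip1.
    rewrite /dotp /=; nra.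
  (* For [h < m] the second-order term is at most [2 * h * r ^+ 2]; the added 1 keeps the
     denominator positive. *)
  pose m := 2 * r ^+ 2 / (dotp l l + 1).
  have l1 : 0 < dotp l l + 1 by rewrite ltr_wpDl ?dotp_ge0.
  exists (Num.min e m).
    by rewrite lt_min e0 divr_gt0// mulr_gt0// exprn_gt0.
  move=> h /andP[h0]; rewrite lt_min => /andP[he hm].
  apply: le_trans (wh s h (ltW h0)); rewrite -/r.
  apply: le_trans ((piP _).2 y (piP _).1) _.
  have -> : z (s + h) - y = (z (s + h) - z s - h *: l) + (z s - y + h *: l).
    by rewrite addrACA addNr addr0 subrKA.
  apply: le_trans (enormD _ _) _.
  have := eP h (introT andP (conj h0 he)); rewrite -/l => zh.
  suff : enorm (z s - y + h *: l) <= r * (1 + (K + 1) * h).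
    by rewrite /c; move: zh; lra.
  have Kh : 0 <= (K + 1) * h by rewrite mulr_ge0 ?addr_ge0// ltW.
  rewrite enorm_le; last by rewrite mulr_ge0 ?addr_ge0// ltW.
  have -> : dotp (z s - y + h *: l) (z s - y + h *: l) =
      d s ^+ 2 + 2 * h * dotp (z s - y) l + h * (h * dotp l l).
    by rewrite sqr_enorm /dotp /= /GRing.scale /=; ring.
  rewrite dsE.
  have hl : h * dotp l l <= 2 * r ^+ 2.
    by move: hm; rewrite ltr_pdivlMr// mulrDr mulr1; lra.
  have := ler_wpM2l (ltW h0) hl.
  have h2 : 0 <= 2 * h by rewrite mulr_ge0// ltW.
  have := ler_wpM2l h2 ly.
  have := sqr_ge0 (r * ((K + 1) * h)).
  lra.
(* Passage to the limit from the left: [r] is so close to [s] that [d] changes by at most [e]. *)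
- move=> s /andP[as_ _] Pr; apply/ler_addgt0Pr => e e0.
  pose r := Num.max a (s - e / (W + 1)).
  have rs : r < s by rewrite gt_max as_ gtrBl divr_gt0.
  have ar : a <= r by rewrite le_max lexx.
  apply: le_trans (dlip r s) _; apply: lerD.
    apply: le_trans (Pr r _) _; first by rewrite ar.
    by rewrite -[leRHS](congr1 (w n) (subrKC r s)) wmono// subr_ge0 ltW.
  apply: le_trans (zlip r s _) _; first by rewrite ar ltW.
  have : s - r <= e / (W + 1) by rewrite lerBlDr -lerBlDl le_max lexx orbT.
  rewrite ler_pdivlMr// mulrC; apply: le_trans.
  by apply: ler_wpM2r; rewrite ?subr_ge0 ?lerDl// ltW.
Qed.

(** * Bounds on the velocity field, uniform in the measure *)

Section Velocity.
Context {R : realType} (a : plane R -> probability (plane R) R -> plane R).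
Hypothesis a_lip : lipschitz_both a.

Lemma velocity_lipschitz : exists2 K : R, 0 <= K &
  forall mu x y, enorm (a x mu - a y mu) <= K * enorm (x - y).
Proof.
(* The absolute value is taken because the sign of [L] is not prescribed. *)
have [L aL] := a_lip; exists `|L| => // mu x y.
apply: le_trans (aL _ _ _ _) _; rewrite gamma_diag addr0.
by apply: ler_wpM2r; rewrite ?enorm_ge0// ler_norm.
Qed.

(** Every measure is within distance 1 of the reference [mu0], so changing the measure costs at most
    the absolute value of [L]. *)
Lemma velocity_bounded (mu0 : probability (plane R) R) :
  bounded_fun (a ^~ mu0) ->
  exists2 V : R, 0 < V & forall mu x, enorm (a x mu) <= V.
Proof.
move=> /pinfty_ex_gt0[M M0 aM]; have [L aL] := a_lip.
exists (`|L| + 2 * M) => [|mu x]; first by rewrite ltr_wpDl// mulr_gt0.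
rewrite -[a x mu](subrK (a x mu0)); apply: le_trans (enormD _ _) _.
apply: lerD; last first.
  by apply: le_trans (enorm_le_norm _) _; rewrite ler_pM2l//; exact: aM.
apply: le_trans (aL _ _ _ _) _; rewrite subrr enorm0 add0r.
apply: (@le_trans _ _ (`|L| * gamma mu mu0)).
  by apply: ler_wpM2r; rewrite ?gamma_ge0// ler_norm.
by apply: ler_piMr; rewrite ?gamma_le1.
Qed.

End Velocity.

(** * Invariance of [D], by time steps of fixed length *)

Theorem theorem6p3 (R : realType)
    (a : plane R -> probability (plane R) R -> plane R)
    (D : set (plane R)) (eps : R) (mu0 : probability (plane R) R)
    (a_lip : lipschitz_both a)
    (a_C1b : forall mu : probability (plane R) R, C1b (a ^~ mu))
    (D_dom : closed_domain D)
    (eps_gt0 : 0 < eps)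
    (mu0_D : prob_on D mu0)
    (a_inward : forall mu : probability (plane R) R,
      prob_on (enlarge D eps) mu ->
      forall x xi : plane R, D x -> regular_normal_cone D x xi ->
        dotp (a x mu) xi <= 0) :
  flow_invariant a mu0 D.
Proof.
move=> x mu [x0 xc dx _ muE].
have cD : closed D by have [G [_ _ _ ->]] := D_dom; exact: closed_closure.
have [K K0 aK] := velocity_lipschitz a_lip.
have [V V0 aV] : exists2 V : R, 0 < V & forall mu x, enorm (a x mu) <= V.
  by have [_ _ aB _] := a_C1b mu0; exact: velocity_bounded aB.
have xlip u s t : D u -> 0 <= s <= t ->
    enorm (x u t - x u s) <= 2 * V * (t - s).
  move=> Du st; apply: (lipschitz_of_bounded_derivative st (xc u Du)).
    by move=> r r0; exact: dx.
  by move=> r _; exact: aV.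
(* In time [delta] no trajectory from [D] moves farther than [eps]. *)
pose delta := eps / (2 * V).
have delta0 : 0 < delta by rewrite divr_gt0// mulr_gt0.
(* The claim covers all [u] in [D] at once, since [mu t] depends on the whole flow. *)
suff H n t u : 0 <= t <= n%:R * delta -> D u -> D (x u t).
  move=> u t Du t0; apply: (H (Num.bound (t / delta))) => //.
  by rewrite t0 -ler_pdivrMr// ltW// archi_boundP// divr_ge0// ltW.
elim: n t u => [|n IHn] t u.
  by rewrite mul0r -eq_le => /eqP <- Du; rewrite x0.
set T := n%:R * delta => /andP[t0]; rewrite mulrSr mulrDl mul1r => tT Du.
have T0 : 0 <= T by rewrite mulr_ge0// ltW.
have [tT'|/ltW Tt] := leP t T; first by apply: IHn; rewrite ?t0.
have TD v : D v -> D (x v T) by apply: IHn; rewrite T0 lexx.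
have muD s : T < s < T + delta -> prob_on (enlarge D eps) (mu s).
  move=> /andP[Ts sT]; have s0 := le_trans T0 (ltW Ts).
  rewrite /prob_on /= muE//; last first.
    by apply: open_measurable_plane; apply: open_enlargeC => //; exists u.
  rewrite (_ : _ `&` _ = set0) ?measure0//; apply/seteqP; split => // v [Dv] /=.
  apply; apply: (mem_enlarge cD _ (TD v Dv)); first by exists u.
  apply: le_trans (xlip _ _ _ Dv _) _; first by rewrite T0 ltW.
  by rewrite -ler_pdivlMl ?mulr_gt0// mulrC -/delta lerBlDl ltW.
(* Along the given solution [mu] is a known function of time, so each trajectory solves an ordinary
   non-autonomous equation. *)
apply: (viability (f := fun s y => a y (mu s)) (K := K) (W := 2 * V) (a := T)
  (b := T + delta) (z := x u)) => //.
- by move=> s r /andP[Ts sr]; apply: xlip => //; rewrite (le_trans T0).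
- by move=> s /andP[Ts _]; apply: dx => //; exact: le_lt_trans Ts.
- by move=> s y xi Ts Dy; apply: a_inward => //; exact: muD.
- exact: TD.
- by rewrite Tt.
Qed.
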